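(* For all integers $n,k\geq 1$, $$\mathscr{T}(n,k) = \frac{1}{k!}\cdot\frac{1}{(k-1)!}\sum_{r=0}^{k-1} T_{n+r}\,\mathscr{T}^{*}(k,r+1),$$ where $\mathscr{T}(n,k)$ are the higher-order tangent numbers, $T_n$ are the tangent numbers and $\mathscr{T}^{*}(n,k)$ are the higher-order arctangent numbers.
   Context: For non-negative integers $n,k$, the higher-order tangent numbers $\mathscr{T}(n,k)$ are defined by the power series expansion $\frac{\tan^{k}t}{k!} = \sum_{n=k}^{\infty}\mathscr{T}(n,k)\frac{t^n}{n!}$, with $\mathscr{T}(n,k)=0$ for $n<k$. The tangent numbers are $T_n := \mathscr{T}(n,1)$, i.e. $\tan t=\sum_{n\ge1}T_n\frac{t^n}{n!}$. The higher-order arctangent numbers $\mathscr{T}^{*}(n,k)$ are defined by $\frac{\arctan^{k}t}{k!} = \sum_{n=k}^{\infty}\mathscr{T}^{*}(n,k)\frac{t^n}{n!}$, with $\mathscr{T}^{*}(n,k)=0$ for $n<k$; equivalently, by the recurrence $\mathscr{T}^{*}(n+1,k)=\mathscr{T}^{*}(n,k-1)-n(n-1)\mathscr{T}^{*}(n-1,k)$ $(n\ge0,k\ge1)$ with $\mathscr{T}^{*}(0,0)=1$ and $\mathscr{T}^{*}(n,0)=0$ for $n\ge1$. *)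

(* Defs.v *)
From Stdlib Require Import Factorial Reals ClassicalEpsilon.
From Coquelicot Require Import Coquelicot.
Open Scope R_scope.

(* [is_egf_from k f a]: the expansion f(t) = \sum_{n >= k} a_n t^n / n! holds
   for all real t in a neighbourhood of 0, with the convention a_n = 0 for
   n < k, so that the sum may be taken from 0. *)
Definition is_egf_from (k : nat) (f : R -> R) (a : nat -> R) : Prop :=
  (forall n : nat, (n < k)%nat -> a n = 0) /\
  locally 0 (fun t : R => is_pseries (fun n => a n / INR (fact n)) t (f t)).

(* There is at most one [a] with [is_egf_from k f a]; the value is unspecified
   for an [f] without such an expansion, which does not happen below since tan
   and arctan are analytic and vanish at 0. *)
Definition egf_coef_from (k : nat) (f : R -> R) : nat -> R :=
  epsilon (inhabits (fun _ : nat => 0)) (is_egf_from k f).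

Definition ho_tangent (n k : nat) : R :=
  egf_coef_from k (fun t => tan t ^ k / INR (fact k)) n.

Definition tangent_number (n : nat) : R := ho_tangent n 1.

Definition ho_arctangent (n k : nat) : R :=
  egf_coef_from k (fun t => atan t ^ k / INR (fact k)) n.

(* Main.v *)
Require Import Defs.
From Stdlib Require Import Factorial Reals Lra Lia Arith ClassicalEpsilon.
From Coquelicot Require Import Coquelicot.
Open Scope R_scope.

(** The identity comes from comparing two three-term recurrences.  Write
    T(n,k) and A(n,k) for the higher-order tangent and arctangent numbers.  Since
    tan' = 1 + tan^2, differentiating tan^(k+1)/(k+1)! gives
      T(n+1,k+1) = T(n,k) + (k+1)(k+2) T(n,k+2),
    and since (1 + t^2) atan' = 1, differentiating atan^(k+1)/(k+1)! gives
      A(n+1,k+1) = A(n,k) - n(n-1) A(n-1,k+1)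
    ([ho_tangent_rec] and [ho_arctangent_rec]).  Read as a recurrence in k, the
    first one determines U_k(n) = k! (k-1)! T(n,k), for n >= 1, by
      U_(k+1)(n) = U_k(n+1) - k(k-1) U_(k-1)(n)
    from U_0 = 0 and U_1(n) = T_n.  The sums over r of T_(n+r) A(k,r+1) satisfy
    the same recurrence in k by the second one, a shift of r turning into a
    shift of n, and they have the same first two values; this is
    [sum_tangent_arctangent].  In other words, (k-1)! tan^k is, up to a
    constant, the combination of the derivatives of tan whose coefficients are
    the A(k,r+1).

    The numbers are chosen among the coefficient sequences of actual
    expansions, so the recurrences can be used only once tan and atan are known
    to be sums of power series near 0.  The equations f' = 1 + f^2, f(0) = 0 for
    f = tan, and (1 + t^2) g = 1 for g = atan', each determine a power series
    with coefficients bounded by 1, hence convergent near 0.  Its sum is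
    identified by comparing functions with the same derivative near 0 and the
    same value at 0: atan f with the identity, and the integrated series of g
    with atan.  Products then give the powers, and uniqueness of expansions turns
    identities between functions into identities between coefficients. *)

(** * Power series expansions at 0 *)

Definition expands (f : R -> R) (a : nat -> R) : Prop :=
  locally 0 (fun t : R => is_pseries a t (f t)).

Lemma locally_within_radius (r : Rbar) :
  Rbar_lt 0 r -> locally 0 (fun t : R => Rbar_lt (Rabs t) r).
Proof.
  destruct r as [r| |]; simpl; intros Hr.
  - exists (mkposreal r Hr); intros t Ht.
    change (Rabs (t - 0) < r) in Ht.
    now rewrite Rminus_0_r in Ht.
  - now exists (mkposreal 1 Rlt_0_1).
  - easy.
Qed.

(** Convergence at one point other than 0 is enough, since outside the disk of
    convergence the general term does not tend to 0. *)
Lemma expands_radius_pos (f : R -> R) (a : nat -> R) :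
  expands f a -> Rbar_lt 0 (CV_radius a).
Proof.
  intros [eps H].
  assert (Heps := cond_pos eps).
  destruct (Rbar_lt_le_dec 0 (CV_radius a)) as [Hlt|Hle]; [exact Hlt|].
  exfalso.
  assert (Hball : ball 0 eps (eps / 2)).
  { change (Rabs (eps / 2 - 0) < eps). rewrite Rabs_pos_eq; lra. }
  specialize (H _ Hball).
  apply (CV_disk_outside a (eps / 2)).
  - apply Rbar_le_lt_trans with (1 := Hle). simpl. rewrite Rabs_pos_eq; lra.
  - apply ex_series_lim_0. exists (f (eps / 2)). now apply is_pseries_R.
Qed.

Lemma expands_PSeries (a : nat -> R) :
  Rbar_lt 0 (CV_radius a) -> expands (PSeries a) a.
Proof.
  intros Ha. apply filter_imp with (2 := locally_within_radius _ Ha).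
  intros t Ht. apply PSeries_correct. now apply CV_radius_inside.
Qed.

Lemma expands_eq_PSeries (f : R -> R) (a : nat -> R) :
  expands f a -> locally 0 (fun t => f t = PSeries a t).
Proof.
  unfold expands. apply filter_imp. intros t Ht. symmetry.
  now apply is_pseries_unique.
Qed.

Lemma expands_ext_loc (f g : R -> R) (a : nat -> R) :
  locally 0 (fun t => f t = g t) -> expands f a -> expands g a.
Proof.
  intros He H. generalize (filter_and _ _ He H). unfold expands. apply filter_imp.
  intros t [E Ht]. now rewrite <- E.
Qed.

Lemma expands_ext_coef (f : R -> R) (a b : nat -> R) :
  (forall n, a n = b n) -> expands f a -> expands f b.
Proof.
  intros He. unfold expands. apply filter_imp. intros t. now apply is_pseries_ext.
Qed.

Lemma expands_unique (f : R -> R) (a b : nat -> R) :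
  expands f a -> expands f b -> forall n, a n = b n.
Proof.
  intros Ha Hb n. apply PSeries_ext_recip.
  - now apply expands_radius_pos with f.
  - now apply expands_radius_pos with f.
  - generalize (filter_and _ _ Ha Hb). apply filter_imp. intros t [H1 H2].
    now rewrite (is_pseries_unique _ _ _ H1), (is_pseries_unique _ _ _ H2).
Qed.

Lemma expands_at_0 (f : R -> R) (a : nat -> R) : expands f a -> a 0%nat = f 0.
Proof.
  intros H. apply locally_singleton in H.
  now rewrite <- (is_pseries_unique _ _ _ H), PSeries_0.
Qed.

Lemma expands_lin (c d : R) (f g : R -> R) (a b : nat -> R) :
  expands f a -> expands g b ->
  expands (fun t => c * f t + d * g t) (fun n => c * a n + d * b n).
Proof.
  intros Ha Hb. generalize (filter_and _ _ Ha Hb). unfold expands. apply filter_imp.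
  intros t [H1 H2].
  apply (is_pseries_plus (PS_scal c a) (PS_scal d b) t (c * f t) (d * g t)).
  - apply (is_pseries_scal c a t (f t)); [apply Rmult_comm|exact H1].
  - apply (is_pseries_scal d b t (g t)); [apply Rmult_comm|exact H2].
Qed.

Lemma expands_var_mult (f : R -> R) (a : nat -> R) :
  expands f a -> expands (fun t => t * f t) (PS_incr_1 a).
Proof.
  unfold expands. apply filter_imp. intros t Ht. now apply is_pseries_incr_1 in Ht.
Qed.

Lemma expands_mult (f g : R -> R) (a b : nat -> R) :
  expands f a -> expands g b -> expands (fun t => f t * g t) (PS_mult a b).
Proof.
  intros Ha Hb.
  generalize (filter_and _ _ (filter_and _ _ Ha Hb)
    (filter_and _ _ (locally_within_radius _ (expands_radius_pos _ _ Ha))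
                    (locally_within_radius _ (expands_radius_pos _ _ Hb)))).
  unfold expands. apply filter_imp. intros t [[H1 H2] [H3 H4]].
  now apply is_pseries_mult.
Qed.

(** The derivative is prescribed on a neighbourhood of 0, so this transfers the
    termwise derivative of the series to any explicit formula for f'. *)
Lemma expands_derive (f f' : R -> R) (a : nat -> R) :
  expands f a -> locally 0 (fun t => is_derive f t (f' t)) ->
  expands f' (PS_derive a).
Proof.
  intros Ha Hd.
  generalize (filter_and _ _ (filter_and _ _
    (locally_locally _ _ (expands_eq_PSeries _ _ Ha)) Hd)
    (locally_within_radius _ (expands_radius_pos _ _ Ha))).
  unfold expands. apply filter_imp. intros t [[H1 H2] H3].
  rewrite <- (is_derive_unique _ _ _ (is_derive_ext_loc _ _ _ _ H1 H2)).
  now apply is_pseries_derive.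
Qed.

Definition unit_coef (n : nat) : R := if Nat.eqb n 0 then 1 else 0.

Lemma expands_one : expands (fun _ => 1) unit_coef.
Proof.
  unfold expands. apply filter_forall. intros t. apply is_pseries_R.
  apply filterlim_ext with (fun _ : nat => 1); [|apply filterlim_const].
  induction x as [|n IH].
  - rewrite sum_O. unfold unit_coef. simpl. ring.
  - rewrite sum_Sn, <- IH. unfold unit_coef, plus. simpl. ring.
Qed.

(** As f vanishes at 0, its series is divisible by t and that of f^k by t^k:
    this yields the vanishing of the coefficients below k. *)
Lemma expands_pow (f : R -> R) (a : nat -> R) (k : nat) :
  expands f a -> f 0 = 0 ->
  exists b, (forall n, (n < k)%nat -> b n = 0) /\ expands (fun t => f t ^ k) b.
Proof.
  intros Ha H0. rewrite <- (expands_at_0 _ _ Ha) in H0.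
  induction k as [|k [b [Hb1 Hb2]]].
  - exists unit_coef. split; [lia|exact expands_one].
  - exists (PS_mult a b). split; [|now apply expands_mult].
    intros n Hn. unfold PS_mult. apply sum_eq_R0. intros [|i] Hi.
    + rewrite H0. ring.
    + rewrite Hb1 by lia. ring.
Qed.

Lemma radius_pos_of_bounded (a : nat -> R) :
  (forall n, Rabs (a n) <= 1) -> Rbar_lt 0 (CV_radius a).
Proof.
  intros H. apply Rbar_lt_le_trans with 1; [simpl; lra|].
  apply (proj1 (CV_radius_bounded a)). exists 1. intros n.
  now rewrite pow1, Rmult_1_r.
Qed.

(** This is how a power series is recognized as tan or atan: no estimate of a
    Taylor remainder is needed, only a differential equation. *)
Lemma eq_loc_of_is_derive (f g h : R -> R) :
  locally 0 (fun t => is_derive f t (h t)) ->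
  locally 0 (fun t => is_derive g t (h t)) ->
  f 0 = g 0 -> locally 0 (fun t => f t = g t).
Proof.
  intros Hf Hg H0. destruct (filter_and _ _ Hf Hg) as [eps H].
  exists eps. intros t Ht. change (Rabs (t - 0) < eps) in Ht.
  rewrite Rminus_0_r in Ht.
  assert (Hd : forall s, Rabs s <= Rabs t ->
    is_derive (fun s => minus (f s) (g s)) s zero).
  { intros s Hs. destruct (H s) as [H1 H2].
    - change (Rabs (s - 0) < eps). rewrite Rminus_0_r. lra.
    - assert (E := is_derive_minus f g s (h s) (h s) H1 H2).
      now rewrite minus_eq_zero in E. }
  enough (minus (f 0) (g 0) = minus (f t) (g t)) as E.
  { unfold minus, plus, opp in E. simpl in E. lra. }
  destruct (Rtotal_order 0 t) as [Hlt|[<-|Hlt]]; [|easy|symmetry];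
    apply (eq_is_derive (fun s => minus (f s) (g s))); trivial;
    intros s Hs; apply Hd.
  - rewrite !Rabs_pos_eq; lra.
  - rewrite !Rabs_left1; lra.
Qed.

(** * Expansion of the tangent *)

(** The value forced on a_(n+1) by f' = 1 + f^2 when f is the sum of the
    a_n t^n. *)
Definition riccati_rhs (a : nat -> R) (n : nat) : R :=
  (unit_coef n + PS_mult a a n) / INR (S n).

(** The recurrence refers to all previous values, so it is not structural in n.
    Picard iteration gets around this: each step makes one more coefficient
    final. *)
Fixpoint tan_approx (m : nat) : nat -> R :=
  match m with
  | O => fun _ => 0
  | S m => fun n => match n with O => 0 | S p => riccati_rhs (tan_approx m) p end
  end.

Definition tan_coef (n : nat) : R := tan_approx n n.

Lemma riccati_rhs_ext (a b : nat -> R) (n : nat) :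
  (forall i, (i <= n)%nat -> a i = b i) -> riccati_rhs a n = riccati_rhs b n.
Proof.
  intros H. unfold riccati_rhs, PS_mult. do 2 f_equal. apply sum_eq.
  intros i Hi. rewrite !H by lia. reflexivity.
Qed.

Lemma tan_approx_stable (m n : nat) :
  (n <= m)%nat -> tan_approx m n = tan_coef n.
Proof.
  assert (Hstep : forall m n, (n <= m)%nat ->
    tan_approx (S m) n = tan_approx m n).
  { clear. induction m as [|m IH]; intros [|p] Hn; try easy; try lia.
    change (riccati_rhs (tan_approx (S m)) p = riccati_rhs (tan_approx m) p).
    apply riccati_rhs_ext. intros i Hi. apply IH. lia. }
  intros H. unfold tan_coef. induction H as [|m H IH]; [easy|].
  now rewrite Hstep.
Qed.

Lemma tan_coef_S (n : nat) : tan_coef (S n) = riccati_rhs tan_coef n.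
Proof.
  apply (riccati_rhs_ext (tan_approx n)). intros i Hi.
  now apply tan_approx_stable.
Qed.

(** The convolution giving (n+1) a_(n+1) has n+1 terms, each at most 1 in
    absolute value, so the bound passes to a_(n+1).  The extra 1 occurs only for
    n = 0, where the convolution is 0. *)
Lemma tan_coef_bounded (n : nat) : Rabs (tan_coef n) <= 1.
Proof.
  induction n as [n IH] using lt_wf_ind. destruct n as [|n].
  - unfold tan_coef. simpl. rewrite Rabs_R0. lra.
  - rewrite tan_coef_S. unfold riccati_rhs.
    assert (Hpos : 0 < INR (S n)) by apply lt_0_INR, Nat.lt_0_succ.
    unfold Rdiv. rewrite Rabs_mult, Rabs_inv, (Rabs_pos_eq (INR _)) by lra.
    apply Rmult_le_reg_r with (INR (S n)); trivial.
    rewrite Rmult_assoc, Rinv_l, Rmult_1_r, Rmult_1_l by lra.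
    destruct n as [|n].
    + unfold unit_coef, PS_mult, tan_coef. simpl. rewrite Rabs_pos_eq; lra.
    + unfold unit_coef, PS_mult. simpl Nat.eqb. rewrite Rplus_0_l.
      apply Rle_trans with (1 := Rsum_abs _ _).
      apply Rle_trans with (sum_f_R0 (fun _ => 1) (S n)).
      * apply sum_Rle. intros i Hi. rewrite Rabs_mult, <- (Rmult_1_r 1).
        apply Rmult_le_compat; try apply Rabs_pos; apply IH; lia.
      * rewrite sum_cte. lra.
Qed.

(** If f' = 1 + f^2 and f(0) = 0 then atan f has derivative 1, whence
    atan (f t) = t and f t = tan t. *)
Lemma expands_tan : expands tan tan_coef.
Proof.
  assert (Hr := radius_pos_of_bounded _ tan_coef_bounded).
  assert (Hf := expands_PSeries _ Hr).
  apply expands_ext_loc with (2 := Hf).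
  assert (Hode : locally 0 (fun t =>
    PSeries (PS_derive tan_coef) t = 1 + PSeries tan_coef t ^ 2)).
  { generalize (expands_lin 1 1 _ _ _ _ expands_one (expands_mult _ _ _ _ Hf Hf)).
    unfold expands. apply filter_imp. intros t Ht.
    rewrite (PSeries_ext _
      (fun n => 1 * unit_coef n + 1 * PS_mult tan_coef tan_coef n)).
    - rewrite (is_pseries_unique _ _ _ Ht). ring.
    - intros n. unfold PS_derive. rewrite tan_coef_S. unfold riccati_rhs.
      field. apply not_0_INR. lia. }
  assert (Hatan : locally 0 (fun t => atan (PSeries tan_coef t) = t)).
  { apply eq_loc_of_is_derive with (h := fun _ => 1).
    - generalize (filter_and _ _ Hode (locally_within_radius _ Hr)).
      apply filter_imp. intros t [H1 H2].
      assert (E : 1 = scal (1 + PSeries tan_coef t ^ 2)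
                        (/ (1 + Rsqr (PSeries tan_coef t)))).
      { unfold scal, Rsqr. simpl. unfold mult. simpl. field.
        assert (H := Rle_0_sqr (PSeries tan_coef t)). unfold Rsqr in H. lra. }
      rewrite E.
      apply (is_derive_comp atan (PSeries tan_coef)); [apply is_derive_atan|].
      rewrite <- H1. now apply is_derive_PSeries.
    - apply filter_forall. intros t. apply (is_derive_id (K := R_AbsRing)).
    - rewrite PSeries_0. apply atan_0. }
  apply filter_imp with (2 := Hatan). intros t Ht.
  now rewrite <- Ht at 2; rewrite tan_atan.
Qed.

(** * Expansion of the arctangent *)

Fixpoint inv_one_plus_sqr_coef (n : nat) : R :=
  match n with
  | O => 1
  | 1%nat => 0
  | S (S m) => - inv_one_plus_sqr_coef m
  end.

Lemma inv_one_plus_sqr_coef_bounded (n : nat) :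
  Rabs (inv_one_plus_sqr_coef n) <= 1.
Proof.
  induction n as [n IH] using lt_wf_ind. destruct n as [|[|n]]; simpl.
  - rewrite Rabs_R1. lra.
  - rewrite Rabs_R0. lra.
  - rewrite Rabs_Ropp. apply IH. lia.
Qed.

(** The recurrence of the coefficients says that (1 + t^2) times the series has
    the coefficients of the constant 1. *)
Lemma expands_inv_one_plus_sqr :
  expands (fun t => / (1 + Rsqr t)) inv_one_plus_sqr_coef.
Proof.
  assert (H := expands_PSeries _
    (radius_pos_of_bounded _ inv_one_plus_sqr_coef_bounded)).
  apply expands_ext_loc with (2 := H).
  assert (H1 : expands (fun _ => 1) (fun n => 1 * inv_one_plus_sqr_coef n
    + 1 * PS_incr_1 (PS_incr_1 inv_one_plus_sqr_coef) n)).
  { apply expands_ext_coef with (2 := expands_one).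
    intros [|[|n]]; unfold unit_coef; simpl; unfold zero; simpl; ring. }
  generalize (filter_and _ _ H1 (expands_lin 1 1 _ _ _ _ H
    (expands_var_mult _ _ (expands_var_mult _ _ H)))).
  apply filter_imp. intros t [E1 E2].
  apply is_pseries_unique in E1. apply is_pseries_unique in E2.
  rewrite E1 in E2. assert (Hs := Rle_0_sqr t). unfold Rsqr in *.
  apply Rmult_eq_reg_r with (1 + t * t); [|lra].
  rewrite Rinv_l by lra. lra.
Qed.

Lemma expands_atan : expands atan (PS_Int inv_one_plus_sqr_coef).
Proof.
  assert (Hr := radius_pos_of_bounded _ inv_one_plus_sqr_coef_bounded).
  rewrite <- CV_radius_Int in Hr.
  apply expands_ext_loc with (2 := expands_PSeries _ Hr).
  apply eq_loc_of_is_derive with (h := fun t => / (1 + Rsqr t)).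
  - generalize (filter_and _ _ expands_inv_one_plus_sqr
      (locally_within_radius _ Hr)).
    apply filter_imp. intros t [H1 H2].
    rewrite <- (is_pseries_unique _ _ _ H1).
    rewrite (PSeries_ext _ (PS_derive (PS_Int inv_one_plus_sqr_coef))).
    + now apply is_derive_PSeries.
    + intros n. unfold PS_derive, PS_Int. field. apply not_0_INR. lia.
  - apply filter_forall. apply is_derive_atan.
  - rewrite PSeries_0, atan_0. reflexivity.
Qed.

(** * Exponential generating functions *)

Definition egf (f : R -> R) (a : nat -> R) : Prop :=
  expands f (fun n => a n / INR (fact n)).

Lemma egf_unique (f : R -> R) (a b : nat -> R) :
  egf f a -> egf f b -> forall n, a n = b n.
Proof.
  intros Ha Hb n. assert (E := expands_unique _ _ _ Ha Hb n). simpl in E.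
  apply Rmult_eq_reg_r with (/ INR (fact n)); [exact E|].
  apply Rinv_neq_0_compat, INR_fact_neq_0.
Qed.

Lemma egf_lin (c d : R) (f g : R -> R) (a b : nat -> R) :
  egf f a -> egf g b ->
  egf (fun t => c * f t + d * g t) (fun n => c * a n + d * b n).
Proof.
  intros Ha Hb. apply expands_ext_coef with (2 := expands_lin c d _ _ _ _ Ha Hb).
  intros n. field. apply INR_fact_neq_0.
Qed.

Lemma egf_derive (f f' : R -> R) (a : nat -> R) :
  egf f a -> locally 0 (fun t => is_derive f t (f' t)) ->
  egf f' (fun n => a (S n)).
Proof.
  intros Ha Hd. apply expands_ext_coef with (2 := expands_derive _ _ _ Ha Hd).
  intros n. unfold PS_derive. rewrite fact_simpl, mult_INR. field.
  split; [apply INR_fact_neq_0|apply not_0_INR; lia].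
Qed.

Lemma egf_var_mult (f : R -> R) (a : nat -> R) :
  egf f a -> egf (fun t => t * f t) (fun n => INR n * a (pred n)).
Proof.
  intros Ha. apply expands_ext_coef with (2 := expands_var_mult _ _ Ha).
  intros [|n].
  - simpl. unfold zero. simpl. field.
  - unfold PS_incr_1, pred. rewrite fact_simpl, mult_INR. field.
    split; [apply INR_fact_neq_0|apply not_0_INR; lia].
Qed.

(** The choice made by [egf_coef_from] is an actual expansion as soon as one
    exists; the powers of an analytic function vanishing at 0 supply it. *)
Lemma egf_coef_from_pow (f : R -> R) (a : nat -> R) (k : nat) :
  expands f a -> f 0 = 0 ->
  is_egf_from k (fun t => f t ^ k / INR (fact k))
    (egf_coef_from k (fun t => f t ^ k / INR (fact k))).
Proof.
  intros Ha H0. unfold egf_coef_from. apply epsilon_spec.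
  destruct (expands_pow f a k Ha H0) as [b [Hb1 Hb2]].
  exists (fun n => INR (fact n) * (b n / INR (fact k))). split.
  - intros n Hn. rewrite Hb1 by trivial. unfold Rdiv. ring.
  - generalize (expands_lin (/ INR (fact k)) 0 _ _ _ _ Hb2 Hb2).
    unfold expands. apply filter_imp. intros t Ht.
    replace (f t ^ k / INR (fact k))
      with (/ INR (fact k) * f t ^ k + 0 * f t ^ k) by (unfold Rdiv; ring).
    apply is_pseries_ext with (2 := Ht). intros n.
    change (/ INR (fact k) * b n + 0 * b n
      = INR (fact n) * (b n / INR (fact k)) / INR (fact n)).
    field. split; apply INR_fact_neq_0.
Qed.

(** The zeroth power is constant, so its derivative, whose coefficients are the
    shifted ones, expands with coefficients 0. *)
Lemma egf_pow_0 (f : R -> R) (a : nat -> R) (n : nat) :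
  egf (fun t => f t ^ 0 / INR (fact 0)) a -> a (S n) = 0.
Proof.
  intros Ha.
  assert (Hd : egf (fun _ => 0) (fun n => a (S n))).
  { apply egf_derive with (1 := Ha). apply filter_forall. intros t.
    apply is_derive_ext with (fun _ : R => 1 / INR (fact 0));
      [easy|exact (is_derive_const _ t)]. }
  rewrite (egf_unique _ _ (fun n => 0 * a n + 0 * a n) Hd); [ring|].
  apply expands_ext_loc with (2 := egf_lin 0 0 _ _ _ _ Ha Ha).
  apply filter_forall. intros t. ring.
Qed.

(** * The recurrences *)

Lemma ho_tangent_spec (k : nat) :
  is_egf_from k (fun t => tan t ^ k / INR (fact k)) (fun n => ho_tangent n k).
Proof. exact (egf_coef_from_pow _ _ k expands_tan tan_0). Qed.

Lemma ho_arctangent_spec (k : nat) :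
  is_egf_from k (fun t => atan t ^ k / INR (fact k))
    (fun n => ho_arctangent n k).
Proof. exact (egf_coef_from_pow _ _ k expands_atan atan_0). Qed.

Lemma is_derive_pow_div_fact (f : R -> R) (k : nat) (t l : R) :
  is_derive f t l ->
  is_derive (fun t => f t ^ S k / INR (fact (S k))) t
    (l * (f t ^ k / INR (fact k))).
Proof.
  intros H.
  replace (l * (f t ^ k / INR (fact k)))
    with (/ INR (fact (S k)) * (INR (S k) * l * f t ^ pred (S k))).
  - apply is_derive_ext with (fun t => / INR (fact (S k)) * f t ^ S k).
    + intros s. apply Rmult_comm.
    + apply is_derive_scal. now apply is_derive_pow.
  - unfold pred. rewrite fact_simpl, mult_INR. field.
    split; [apply INR_fact_neq_0|apply not_0_INR; lia].
Qed.

(** Coefficients of (tan^(k+1)/(k+1)!)' = (1 + tan^2) tan^k/k!, where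
    tan^(k+2)/k! is (k+1)(k+2) times tan^(k+2)/(k+2)!. *)
Lemma ho_tangent_rec (n k : nat) :
  ho_tangent (S n) (S k) =
    ho_tangent n k + INR (S k) * INR (S (S k)) * ho_tangent n (S (S k)).
Proof.
  rewrite <- (Rmult_1_l (ho_tangent n k)). revert n.
  apply egf_unique with (fun t => 1 * (tan t ^ k / INR (fact k))
    + INR (S k) * INR (S (S k)) * (tan t ^ S (S k) / INR (fact (S (S k))))).
  - apply (egf_derive _ _ (fun n => ho_tangent n (S k)))
      with (1 := proj2 (ho_tangent_spec (S k))).
    assert (Hc : locally 0 (fun t => cos t <> 0)).
    { apply (continuous_cos 0 (fun y => y <> 0)).
      apply open_neq. rewrite cos_0. exact R1_neq_R0. }
    apply filter_imp with (2 := Hc). intros t Ht.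
    replace (1 * _ + _) with ((tan t ^ 2 + 1) * (tan t ^ k / INR (fact k))).
    + now apply is_derive_pow_div_fact, is_derive_tan.
    + rewrite !fact_simpl, !mult_INR. simpl pow. field.
      repeat split; try apply INR_fact_neq_0; apply not_0_INR; lia.
  - apply (egf_lin _ _ _ _ (fun n => ho_tangent n k)
      (fun n => ho_tangent n (S (S k)))); apply ho_tangent_spec.
Qed.

(** Coefficients of (1 + t^2) (atan^(k+1)/(k+1)!)' = atan^k/k!.  The two
    multiplications by t produce the factor n(n-1); it vanishes at n = 0, where
    [pred] does not give n - 1. *)
Lemma ho_arctangent_rec (n k : nat) :
  ho_arctangent (S n) (S k) =
    ho_arctangent n k - INR n * INR (pred n) * ho_arctangent (pred n) (S k).
Proof.
  assert (H := ho_arctangent_spec (S k)). destruct H as [_ H].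
  assert (Hd : egf (fun t => / (1 + Rsqr t) * (atan t ^ k / INR (fact k)))
                 (fun n => ho_arctangent (S n) (S k))).
  { apply (egf_derive _ _ (fun n => ho_arctangent n (S k))) with (1 := H).
    apply filter_forall. intros t.
    now apply is_derive_pow_div_fact, is_derive_atan. }
  assert (E := egf_lin 1 1 _ _ _ _ Hd (egf_var_mult _ _ (egf_var_mult _ _ Hd))).
  assert (E' : egf (fun t => atan t ^ k / INR (fact k))
    (fun n => 1 * ho_arctangent (S n) (S k) + 1 * (INR n *
      (INR (pred n) * ho_arctangent (S (pred (pred n))) (S k))))).
  { apply expands_ext_loc with (2 := E). apply filter_forall. intros t.
    assert (Hs := Rle_0_sqr t). unfold Rsqr in *. field.
    split; [apply INR_fact_neq_0|lra]. }
  rewrite (egf_unique _ _ _ (proj2 (ho_arctangent_spec k)) E' n).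
  destruct n as [|[|n]]; simpl; ring.
Qed.

Lemma ho_tangent_S_0 (n : nat) : ho_tangent (S n) 0 = 0.
Proof. exact (egf_pow_0 tan _ n (proj2 (ho_tangent_spec 0))). Qed.

Lemma ho_arctangent_S_0 (n : nat) : ho_arctangent (S n) 0 = 0.
Proof. exact (egf_pow_0 atan _ n (proj2 (ho_arctangent_spec 0))). Qed.

Lemma ho_arctangent_0_0 : ho_arctangent 0 0 = 1.
Proof.
  assert (H := expands_at_0 _ _ (proj2 (ho_arctangent_spec 0))).
  simpl in H. lra.
Qed.

(** * The identity *)

(** The upper bound N of the sum is any N >= k - 1, the extra terms being 0:
    this freedom lets the sums for k - 1, k and k + 1 be compared termwise.  The
    restriction n >= 1 comes from T(0,0) = 1, which spoils the case k = 0. *)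
Lemma sum_tangent_arctangent (k N n : nat) :
  (k <= S N)%nat -> (1 <= n)%nat ->
  sum_f_R0 (fun r => tangent_number (n + r) * ho_arctangent k (S r)) N =
    INR (fact k) * INR (fact (pred k)) * ho_tangent n k.
Proof.
  revert N n. induction k as [k IH] using lt_wf_ind. intros N n HN Hn.
  destruct n as [|n]; [lia|]. destruct k as [|[|k]].
  - rewrite ho_tangent_S_0, Rmult_0_r. apply sum_eq_R0. intros r Hr.
    rewrite (proj1 (ho_arctangent_spec (S r))) by lia. ring.
  - assert (A1 : forall r, ho_arctangent 1 (S r) = ho_arctangent 0 r).
    { intros r. rewrite ho_arctangent_rec. simpl. ring. }
    destruct N as [|N].
    + simpl sum_f_R0. rewrite A1, ho_arctangent_0_0, Nat.add_0_r.
      unfold tangent_number. simpl. ring.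
    + rewrite decomp_sum by lia. rewrite sum_eq_R0.
      * rewrite A1, ho_arctangent_0_0, Nat.add_0_r. unfold tangent_number. simpl. ring.
      * intros r Hr. rewrite A1, (proj1 (ho_arctangent_spec (S r))) by lia. ring.
  - destruct N as [|N]; [lia|].
    transitivity
      (sum_f_R0 (fun r => tangent_number (S n + r) * ho_arctangent (S k) r)
         (S N)
       - INR (S k) * INR k *
         sum_f_R0 (fun r => tangent_number (S n + r) * ho_arctangent k (S r))
           (S N)).
    { rewrite scal_sum, <- minus_sum. apply sum_eq. intros r _.
      rewrite ho_arctangent_rec. simpl pred. ring. }
    rewrite IH by lia.
    (* The term r = 0 vanishes; shifting r turns n into n + 1. *)
    rewrite decomp_sum by lia. rewrite ho_arctangent_S_0. simpl pred.
    rewrite (sum_eq _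
      (fun r => tangent_number (S (S n) + r) * ho_arctangent (S k) (S r))).
    2: { intros r _. now rewrite Nat.add_succ_r. }
    rewrite IH by lia.
    rewrite (ho_tangent_rec (S n) k). simpl pred.
    destruct k as [|k].
    + rewrite ho_tangent_S_0. simpl. ring.
    + simpl pred. rewrite !fact_simpl, !mult_INR. ring.
Qed.

Theorem proposition7 (n k : nat) (hn : (1 <= n)%nat) (hk : (1 <= k)%nat) :
  ho_tangent n k =
    1 / INR (fact k) * (1 / INR (fact (k - 1))) *
      sum_f_R0 (fun r => tangent_number (n + r) * ho_arctangent k (r + 1))
        (k - 1).
Proof.
  rewrite (sum_eq _ (fun r => tangent_number (n + r) * ho_arctangent k (S r))).
  2: { intros r _. now rewrite Nat.add_1_r. }
  rewrite sum_tangent_arctangent, <- Nat.sub_1_r by lia.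
  field. split; apply INR_fact_neq_0.
Qed.
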